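(* Let $\omega(x,y,z) = x[y,z] + z[x,y] + [z,x]y$ (the anti-Jordan family, $q=\infty$) and $\omega'(x,y,z) = [x,[y,z]]$ (the Lie family, $q=\infty$), where $[u,v]=uv-vu$. Then the universal associative envelope $U(A^{\omega})$ is isomorphic to the down-up algebra $A(2,-1,-2)$, so that $U(A^{\omega}) \cong U(A^{\omega'})$ as unital associative algebras.
   Context: $\mathbb{F}$ is a field of characteristic $0$. $A$ is the 2-dimensional space of $2\times 2$ matrices over $\mathbb{F}$ with zero diagonal, with basis $e_1 = \begin{bmatrix} 0&1\\0&0\end{bmatrix}$, $e_2 = \begin{bmatrix} 0&0\\1&0\end{bmatrix}$; it is closed under triple products $xyz$ of matrices. For a trilinear operation $\omega(x,y,z)$ (a fixed rational linear combination of the six products of $x,y,z$ in all orders), $A^\omega$ denotes the space $A$ with the trilinear operation $\omega$ computed using matrix multiplication. Let $\mathbb{F}\langle a,b\rangle$ be the free unital associative algebra and $\phi\colon A \to \mathbb{F}\langle a,b\rangle$ the linear map with $\phi(e_1)=a$, $\phi(e_2)=b$. The universal associative envelope is $U(A^\omega) = \mathbb{F}\langle a,b\rangle / I$, where $I$ is the two-sided ideal generated by the elements $\omega(\phi(x),\phi(y),\phi(z)) - \phi(\omega(x,y,z))$ for $x,y,z\in\{e_1,e_2\}$. For $\alpha,\beta,\gamma\in\mathbb{F}$, the down-up algebra $A(\alpha,\beta,\gamma)$ is the unital associative $\mathbb{F}$-algebra with generators $a,b$ and relations $b^2a = \alpha bab + \beta ab^2 + \gamma b$ and $ba^2 = \alpha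 aba + \beta a^2 b + \gamma a$. *)

(* Defs.v *)
From HB Require Import structures.
From mathcomp Require Import all_boot all_order all_algebra.
From mathcomp Require Import generic_quotient ring_quotient.
From mathcomp Require Import ssrAC boolp.
From mathcomp.multinomials Require Import monalg.

Set Implicit Arguments.
Unset Strict Implicit.
Unset Printing Implicit Defensive.

Import GRing.Theory.
Local Open Scope ring_scope.
Local Open Scope quotient_scope.

(* Isomorphism of unital associative algebras. This is a notation because
   lalgType and algType carry the axiom 1 != 0, which a quotient algebra need
   not satisfy: the quotients below have canonical pzRingType and lmodType
   structures, related by alg_quot_scaleAl and alg_quot_scaleAr. *)
Notation alg_isomorphic B C :=
  (exists f : B -> C, [/\ linear f, monoid_morphism f & bijective f]).

Section AlgebraQuotient.
Variables (F : pzRingType) (B : algType F).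

Definition two_sided_ideal (J : B -> Prop) : Prop :=
  [/\ J 0, forall x y, J x -> J y -> J (x - y)
    & forall b x c, J x -> J (b * x * c)].

Definition ideal_gen (S : B -> Prop) : {pred B} := fun x =>
  `[< forall J, two_sided_ideal J -> (forall s, S s -> J s) -> J x >].

Variable S : B -> Prop.

Lemma ideal_genP x : reflect
  (forall J, two_sided_ideal J -> (forall s, S s -> J s) -> J x)
  (x \in ideal_gen S).
Proof. exact: asboolP. Qed.

Lemma ideal_gen_zmod_closed : zmod_closed (ideal_gen S).
Proof.
split=> [|x y /ideal_genP Ix /ideal_genP Iy]; apply/ideal_genP=> J idJ SJ.
  by case: idJ.
by case: (idJ) => _ JB _; apply: JB; [apply: Ix | apply: Iy].
Qed.

HB.instance Definition _ :=
  GRing.isZmodClosed.Build B (ideal_gen S) ideal_gen_zmod_closed.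

Lemma ideal_gen_mul b x c :
  x \in ideal_gen S -> b * x * c \in ideal_gen S.
Proof.
move=> /ideal_genP Ix; apply/ideal_genP=> J idJ SJ.
by case: (idJ) => _ _; apply; apply: Ix.
Qed.

Lemma ideal_genMl b x : x \in ideal_gen S -> b * x \in ideal_gen S.
Proof. by move=> Ix; rewrite -[b * x]mulr1 ideal_gen_mul. Qed.

Lemma ideal_genMr x c : x \in ideal_gen S -> x * c \in ideal_gen S.
Proof. by move=> Ix; rewrite -[x]mul1r ideal_gen_mul. Qed.

Lemma ideal_genZ k x : x \in ideal_gen S -> k *: x \in ideal_gen S.
Proof. by move=> Ix; rewrite -[x]mul1r scalerAl ideal_genMl. Qed.

Definition alg_quot : Type := Quotient.quot (ideal_gen S).

HB.instance Definition _ := GRing.Zmodule.on alg_quot.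
HB.instance Definition _ := EqQuotient.on alg_quot.

Lemma alg_quot_eqE (x y : B) :
  (\pi_alg_quot x == \pi_alg_quot y) = (x - y \in ideal_gen S).
Proof. by rewrite [RHS]Quotient.idealrBE. Qed.

Lemma alg_quot_eqP (x y : B) :
  x - y \in ideal_gen S -> \pi_alg_quot x = \pi_alg_quot y.
Proof. by rewrite -alg_quot_eqE => /eqP. Qed.

Lemma ideal_gen_repr x : repr (\pi_alg_quot x) - x \in ideal_gen S.
Proof. by rewrite -alg_quot_eqE reprK. Qed.

Lemma alg_quot_piD (x y : B) :
  \pi_alg_quot (x + y) = \pi_alg_quot x + \pi_alg_quot y.
Proof. exact: Quotient.pi_add. Qed.

Definition alg_quot_one : alg_quot := \pi_alg_quot 1.
Definition alg_quot_mul (u v : alg_quot) : alg_quot :=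
  \pi_alg_quot (repr u * repr v : B).
Definition alg_quot_scale (k : F) (u : alg_quot) : alg_quot :=
  \pi_alg_quot (k *: (repr u : B)).

Lemma alg_quot_mul_pi x y :
  alg_quot_mul (\pi_alg_quot x) (\pi_alg_quot y) = \pi_alg_quot (x * y).
Proof.
apply: alg_quot_eqP.
move: (repr (\pi_alg_quot x)) (ideal_gen_repr x) => x' Ix.
move: (repr (\pi_alg_quot y)) (ideal_gen_repr y) => y' Iy.
rewrite -(subrK (x * y') (x' * y')) -addrA -mulrBl -mulrBr.
by apply: rpredD; [exact: ideal_genMr | exact: ideal_genMl].
Qed.

Lemma alg_quot_scale_pi k x :
  alg_quot_scale k (\pi_alg_quot x) = \pi_alg_quot (k *: x).
Proof.
apply: alg_quot_eqP; rewrite -scalerBr.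
exact/ideal_genZ/ideal_gen_repr.
Qed.

Fact alg_quot_mulA : associative alg_quot_mul.
Proof.
elim/quotW=> x; elim/quotW=> y; elim/quotW=> z.
rewrite (alg_quot_mul_pi y z) (alg_quot_mul_pi x y).
by rewrite (alg_quot_mul_pi x) (alg_quot_mul_pi _ z) mulrA.
Qed.

Fact alg_quot_1mul : left_id alg_quot_one alg_quot_mul.
Proof. by elim/quotW=> x; rewrite alg_quot_mul_pi mul1r. Qed.

Fact alg_quot_mul1 : right_id alg_quot_one alg_quot_mul.
Proof. by elim/quotW=> x; rewrite alg_quot_mul_pi mulr1. Qed.

Fact alg_quot_mulDl : left_distributive alg_quot_mul +%R.
Proof.
elim/quotW=> x; elim/quotW=> y; elim/quotW=> z.
rewrite -alg_quot_piD (alg_quot_mul_pi x z) (alg_quot_mul_pi y z).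
by rewrite -alg_quot_piD alg_quot_mul_pi mulrDl.
Qed.

Fact alg_quot_mulDr : right_distributive alg_quot_mul +%R.
Proof.
elim/quotW=> x; elim/quotW=> y; elim/quotW=> z.
rewrite -alg_quot_piD (alg_quot_mul_pi x y) (alg_quot_mul_pi x z).
by rewrite -alg_quot_piD alg_quot_mul_pi mulrDr.
Qed.

HB.instance Definition _ := GRing.Zmodule_isPzRing.Build alg_quot
  alg_quot_mulA alg_quot_1mul alg_quot_mul1 alg_quot_mulDl alg_quot_mulDr.

Fact alg_quot_scaleA k l u :
  alg_quot_scale k (alg_quot_scale l u) = alg_quot_scale (k * l) u.
Proof.
elim/quotW: u => x.
by rewrite (alg_quot_scale_pi l) !alg_quot_scale_pi scalerA.
Qed.

Fact alg_quot_scale1 : left_id 1 alg_quot_scale.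
Proof. by elim/quotW=> x; rewrite alg_quot_scale_pi scale1r. Qed.

Fact alg_quot_scaleDr : right_distributive alg_quot_scale +%R.
Proof.
move=> k; elim/quotW=> x; elim/quotW=> y.
rewrite -alg_quot_piD (alg_quot_scale_pi k x) (alg_quot_scale_pi k y).
by rewrite -alg_quot_piD alg_quot_scale_pi scalerDr.
Qed.

Fact alg_quot_scaleDl u : {morph alg_quot_scale^~ u : k l / k + l}.
Proof.
elim/quotW: u => x k l.
rewrite /= (alg_quot_scale_pi k) (alg_quot_scale_pi l).
by rewrite -alg_quot_piD alg_quot_scale_pi scalerDl.
Qed.

HB.instance Definition _ := GRing.Zmodule_isLmodule.Build F alg_quot
  alg_quot_scaleA alg_quot_scale1 alg_quot_scaleDr alg_quot_scaleDl.

Lemma alg_quot_piM (x y : B) :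
  \pi_alg_quot (x * y) = \pi_alg_quot x * \pi_alg_quot y.
Proof. by rewrite -alg_quot_mul_pi. Qed.

Lemma alg_quot_piZ k (x : B) : \pi_alg_quot (k *: x) = k *: \pi_alg_quot x.
Proof. by rewrite -alg_quot_scale_pi. Qed.

Lemma alg_quot_scaleAl k (u v : alg_quot) : k *: (u * v) = (k *: u) * v.
Proof.
elim/quotW: u => x; elim/quotW: v => y.
by rewrite -alg_quot_piM -!alg_quot_piZ -alg_quot_piM scalerAl.
Qed.

Lemma alg_quot_scaleAr k (u v : alg_quot) : k *: (u * v) = u * (k *: v).
Proof.
elim/quotW: u => x; elim/quotW: v => y.
by rewrite -alg_quot_piM -!alg_quot_piZ -alg_quot_piM scalerAr.
Qed.

End AlgebraQuotient.

Lemma malg_scalerAr (K : monomType) (R : comNzRingType) (k : R)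
    (x y : {malg R[K]}) : k *: (x * y) = x * (k *: y).
Proof.
apply/malgP=> m; rewrite mcoeffZ mcoeffMl.
rewrite (mcoeffMlw (d1 := msupp x) (d2 := msupp y)) ?msuppZ_le //.
rewrite mulr_sumr; apply: eq_bigr => i _; rewrite mulr_sumr.
by apply: eq_bigr => j _; rewrite mcoeffZ mulrnAr mulrCA.
Qed.

(* The monoid algebra of the free monoid on two letters. *)
Definition free_alg (F : fieldType) : Type := {malg F[{fmonom 'I_2}]}.

Section FreeAlgebra.
Variable F : fieldType.

HB.instance Definition _ := GRing.Lalgebra.on (free_alg F).

Fact free_alg_scalerAr (k : F) (x y : free_alg F) : k *: (x * y) = x * (k *: y).
Proof. exact: malg_scalerAr. Qed.

HB.instance Definition _ :=
  GRing.Lalgebra_isAlgebra.Build F (free_alg F) free_alg_scalerAr.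

Definition gen_a : free_alg F := << fmu (ord0 : 'I_2) >>.
Definition gen_b : free_alg F := << fmu (ord_max : 'I_2) >>.

End FreeAlgebra.

Section DownUp.
Variable F : fieldType.
Local Notation a := (gen_a F).
Local Notation b := (gen_b F).

Definition down_up_rel (alpha beta gamma : F) (r : free_alg F) : Prop :=
     r = b ^+ 2 * a
         - (alpha *: (b * a * b) + beta *: (a * b ^+ 2) + gamma *: b)
  \/ r = b * a ^+ 2
         - (alpha *: (a * b * a) + beta *: (a ^+ 2 * b) + gamma *: a).

Definition down_up_algebra (alpha beta gamma : F) : Type :=
  alg_quot (down_up_rel alpha beta gamma).

HB.instance Definition _ (alpha beta gamma : F) :=
  GRing.PzRing.on (down_up_algebra alpha beta gamma).
HB.instance Definition _ (alpha beta gamma : F) :=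
  GRing.Lmodule.on (down_up_algebra alpha beta gamma).

End DownUp.

Section TrilinearOperation.
Variable F : fieldType.

Definition trilinear_comb (q1 q2 q3 q4 q5 q6 : rat)
    (B : algType F) (x y z : B) : B :=
  ratr q1 *: (x * y * z) + ratr q2 *: (x * z * y) + ratr q3 *: (y * x * z)
  + ratr q4 *: (y * z * x) + ratr q5 *: (z * x * y) + ratr q6 *: (z * y * x).

(* An operation given uniformly on all associative algebras by one formula, so
   that it can be evaluated both on matrices and in the free algebra. *)
Record trilinear_op := TrilinearOp {
  tri_op :> forall B : algType F, B -> B -> B -> B;
  tri_opP : exists q1 q2 q3 q4 q5 q6 : rat, forall (B : algType F) (x y z : B),
    tri_op x y z = trilinear_comb q1 q2 q3 q4 q5 q6 x y z
}.

Definition commutator (B : algType F) (u v : B) : B := u * v - v * u.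

Definition anti_jordan_op (B : algType F) (x y z : B) : B :=
  x * commutator y z + z * commutator x y + commutator z x * y.

Definition lie_op (B : algType F) (x y z : B) : B := commutator x (commutator y z).

Fact anti_jordan_opP : exists q1 q2 q3 q4 q5 q6 : rat,
  forall (B : algType F) (x y z : B),
    anti_jordan_op x y z = trilinear_comb q1 q2 q3 q4 q5 q6 x y z.
Proof.
exists 1%:~R, (-2)%:~R, 0%:~R, 0%:~R, 2%:~R, (-1)%:~R => B x y z.
rewrite /trilinear_comb !ratr_int !scaler_int mulr0z !addr0 mulr1z mulrN1z.
rewrite /anti_jordan_op /commutator !mulrBr !mulrBl !mulrA.
rewrite mulrNz -!pmulrn !mulr2n opprD !addrA.
by rewrite [LHS](ACl (1*2*6*3*5*4)).
Qed.

Fact lie_opP : exists q1 q2 q3 q4 q5 q6 : rat,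
  forall (B : algType F) (x y z : B),
    lie_op x y z = trilinear_comb q1 q2 q3 q4 q5 q6 x y z.
Proof.
exists 1%:~R, (-1)%:~R, 0%:~R, (-1)%:~R, 0%:~R, 1%:~R => B x y z.
rewrite /trilinear_comb !ratr_int !scaler_int !mulr0z !addr0 !mulr1z !mulrN1z.
rewrite /lie_op /commutator !mulrBr !mulrBl !mulrA.
by rewrite opprB addrA addrAC.
Qed.

Definition anti_jordan : trilinear_op := TrilinearOp anti_jordan_opP.
Definition lie : trilinear_op := TrilinearOp lie_opP.

End TrilinearOperation.

Section ZeroDiagonal.
Variable F : fieldType.

Definition zero_diag : {pred 'M[F]_2} := fun M => [forall i, M i i == 0].

Lemma zero_diagP (M : 'M[F]_2) :
  reflect (forall i, M i i = 0) (M \in zero_diag).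
Proof. exact: 'forall_eqP. Qed.

Fact zero_diag_submod_closed : submod_closed zero_diag.
Proof.
split=> [|k M N /zero_diagP M0 /zero_diagP N0]; apply/zero_diagP=> i.
  by rewrite mxE.
by rewrite !mxE M0 N0 mulr0 addr0.
Qed.

HB.instance Definition _ :=
  GRing.isSubmodClosed.Build F 'M[F]_2 zero_diag zero_diag_submod_closed.

Record zmat : Type := ZMat { zmat_val :> 'M[F]_2; _ : zmat_val \in zero_diag }.

HB.instance Definition _ := [isSub for zmat_val].
HB.instance Definition _ := [Choice of zmat by <:].
HB.instance Definition _ := [SubChoice_isSubLmodule of zmat by <:].

Lemma zmat_diag (x : zmat) i : (x : 'M[F]_2) i i = 0.
Proof. by case: x => M /= /zero_diagP. Qed.

Fact zero_diag_delta (i j : 'I_2) : i != j -> delta_mx i j \in zero_diag.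
Proof.
move=> ij; apply/zero_diagP=> k; rewrite mxE.
by case: eqP => // ->; rewrite (negbTE ij).
Qed.

Definition mat_e1 : zmat := ZMat (@zero_diag_delta 0 1 isT).
Definition mat_e2 : zmat := ZMat (@zero_diag_delta 1 0 isT).

Lemma zmat_basis (x : zmat) :
  x = (x : 'M[F]_2) 0 1 *: mat_e1 + (x : 'M[F]_2) 1 0 *: mat_e2.
Proof.
apply: val_inj; apply/matrixP=> i j; rewrite !mxE.
have I2 (k : 'I_2) : k = 0 \/ k = 1.
  by case: k => -[|[|//]] hk; [left | right]; apply: val_inj.
have [->|->] := I2 i; have [->|->] := I2 j;
  by rewrite ?zmat_diag /= ?mulr0 ?mulr1 ?add0r ?addr0.
Qed.

Fact zero_diag_mul3 (x y z : zmat) :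
  (x : 'M[F]_2) * (y : 'M[F]_2) * (z : 'M[F]_2) \in zero_diag.
Proof.
apply/zero_diagP=> i; rewrite !mxE big_ord_recl big_ord1 !mxE.
rewrite !big_ord_recl !big_ord0.
have [->|->] : i = ord0 \/ i = lift ord0 ord0.
  by case: i => -[|[|//]] hk; [left | right]; apply: val_inj.
all: by rewrite !zmat_diag !(mul0r, mulr0, addr0).
Qed.

Fact zero_diag_op (w : trilinear_op F) (x y z : zmat) :
  w 'M[F]_2 x y z \in zero_diag.
Proof.
case: w => w [q1 [q2 [q3 [q4 [q5 [q6 wE]]]]]] /=; rewrite wE.
by rewrite /trilinear_comb !rpredD // rpredZ // zero_diag_mul3.
Qed.

Definition zmat_op (w : trilinear_op F) (x y z : zmat) : zmat :=
  ZMat (zero_diag_op w x y z).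

Definition phi (x : zmat) : free_alg F :=
  (x : 'M[F]_2) 0 1 *: gen_a F + (x : 'M[F]_2) 1 0 *: gen_b F.

Fact zmat_comb_linear (V : lmodType F) (a b : V) :
  linear (fun x : zmat => (x : 'M[F]_2) 0 1 *: a + (x : 'M[F]_2) 1 0 *: b).
Proof.
by move=> k x y; rewrite !mxE !scalerDl scalerDr !scalerA addrACA.
Qed.

Fact phi_linear : linear phi.
Proof. exact: zmat_comb_linear. Qed.

HB.instance Definition _ :=
  GRing.isLinear.Build F zmat (free_alg F) _ phi phi_linear.

Lemma phi_e1 : phi mat_e1 = gen_a F.
Proof.
rewrite /phi; move: (gen_a F) (gen_b F) => a b.
by rewrite !mxE scale1r scale0r addr0.
Qed.

Lemma phi_e2 : phi mat_e2 = gen_b F.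
Proof.
rewrite /phi; move: (gen_a F) (gen_b F) => a b.
by rewrite !mxE scale1r scale0r add0r.
Qed.

End ZeroDiagonal.

Section UniversalEnvelope.
Variables (F : fieldType) (w : trilinear_op F).

Definition envelope_rel (r : free_alg F) : Prop :=
  exists x y z : zmat F,
    [/\ x \in [:: mat_e1 F; mat_e2 F],
        y \in [:: mat_e1 F; mat_e2 F],
        z \in [:: mat_e1 F; mat_e2 F]
      & r = w _ (phi x) (phi y) (phi z) - phi (zmat_op w x y z)].

Definition universal_envelope : Type := alg_quot envelope_rel.

HB.instance Definition _ := GRing.PzRing.on universal_envelope.
HB.instance Definition _ := GRing.Lmodule.on universal_envelope.

End UniversalEnvelope.

(* Main.v *)
(** Evaluated on triples [(x,x,z)], [(x,z,x)], [(z,x,x)], both operations are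
    scalar multiples of [[x,[x,z]]], with coefficients (1, 0, -1) for the
    anti-Jordan operation and (1, -1, 0) for the Lie one. Triples from
    [{e1, e2}] always have a repeated entry, and [[e1,[e1,e2]] = -2 e1],
    [[e2,[e2,e1]] = -2 e2]; hence the ideals defining both envelopes are
    generated by [[a,[a,b]] + 2a] and [[b,[b,a]] + 2b], which are the down-up
    relations with parameters (2, -1, -2). *)

Require Import Defs.
From mathcomp Require Import all_boot all_algebra.

Set Implicit Arguments.
Unset Strict Implicit.
Unset Printing Implicit Defensive.

Import GRing.Theory.
Local Open Scope ring_scope.
Local Open Scope quotient_scope.

Section IdealGen.
Variables (F : pzRingType) (B : algType F).
Implicit Types S T : B -> Prop.

Lemma mem_ideal_gen S x : S x -> x \in ideal_gen S.
Proof. by move=> Sx; apply/ideal_genP=> J _; apply. Qed.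

(** The ideal generated by [T] is itself one of the two-sided ideals [J] over which [ideal_gen S]
    quantifies. *)
Lemma ideal_gen_min S T :
  (forall x, S x -> x \in ideal_gen T) -> {subset ideal_gen S <= ideal_gen T}.
Proof.
move=> ST x /ideal_genP/(_ (fun y => y \in ideal_gen T)); apply=> //.
split=> [|y z Ty Tz|b y c Ty].
- exact: rpred0.
- exact: rpredB.
- exact: ideal_gen_mul.
Qed.

Lemma alg_quot_map S T : {subset ideal_gen S <= ideal_gen T} ->
  exists f : alg_quot S -> alg_quot T,
    forall x, f (\pi_(alg_quot S) x) = \pi_(alg_quot T) x.
Proof.
move=> ST; exists (fun u => \pi_(alg_quot T) (repr u)) => x.
by apply/alg_quot_eqP/ST/ideal_gen_repr.
Qed.

(** Ideals with the same elements still give quotients that are distinct types, so the identity of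
    [B] is passed to the quotients in both directions. The projections are surjective, which reduces
    every check to images of elements of [B]. *)
Lemma alg_quot_isomorphic S T :
  ideal_gen S =i ideal_gen T -> alg_isomorphic (alg_quot S) (alg_quot T).
Proof.
move=> eqST.
have [x|f fpi] := @alg_quot_map S T; first by rewrite eqST.
have [x|g gpi] := @alg_quot_map T S; first by rewrite eqST.
exists f; split.
- move=> k; elim/quotW=> x; elim/quotW=> y.
  by rewrite -alg_quot_piZ -alg_quot_piD !fpi alg_quot_piD alg_quot_piZ.
- split; first exact: fpi.
  elim/quotW=> x; elim/quotW=> y.
  by rewrite -alg_quot_piM !fpi alg_quot_piM.
- by exists g => u; elim/quotW: u => x; rewrite ?gpi ?fpi ?gpi.
Qed.

End IdealGen.

Section Envelope.
Variable F : fieldType.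

Lemma lie_opxx (B : algType F) (x y : B) :
  lie_op x x y = y * x ^+ 2 - (2 *: (x * y * x) - x ^+ 2 * y).
Proof.
rewrite /lie_op /commutator mulrBr mulrBl !expr2 !mulrA scaler_nat mulr2n.
rewrite !opprB !addrA opprD addrA [y * x * x + _]addrC.
by congr (_ - _); exact: addrAC.
Qed.

(** The expansion of [[x,[x,y]]] is a palindrome. This order of terms fits the down-up relation that
    starts with [b ^+ 2 * a], the previous one that with [b * a ^+ 2]. *)
Lemma lie_opxx_sym (B : algType F) (x y : B) :
  lie_op x x y = x ^+ 2 * y - (2 *: (x * y * x) - y * x ^+ 2).
Proof. by rewrite lie_opxx !opprB addrCA. Qed.

Lemma lie_op_xyx (B : algType F) (x y : B) : lie_op x y x = - lie_op x x y.
Proof.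
have comm_opp (u v : B) : commutator u v = - commutator v u.
  by rewrite /commutator opprB.
by rewrite /lie_op (comm_opp y) /commutator mulrN mulNr opprB opprK addrC.
Qed.

Lemma lie_op_yxx (B : algType F) (x y : B) : lie_op y x x = 0.
Proof. by rewrite /lie_op /commutator subrr mulr0 mul0r subrr. Qed.

Lemma anti_jordan_op_xxy (B : algType F) (x y : B) :
  anti_jordan_op x x y = lie_op x x y.
Proof.
rewrite /anti_jordan_op /lie_op /commutator subrr mulr0 addr0.
by rewrite -[y * x - _]opprB mulNr.
Qed.

(** The outer terms [x[y,x]] and [x[x,y]] cancel, and [[x,x]y] vanishes. *)
Lemma anti_jordan_op_xyx (B : algType F) (x y : B) : anti_jordan_op x y x = 0.
Proof.
rewrite /anti_jordan_op /commutator subrr mul0r addr0 -mulrDr.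
by rewrite addrA subrK subrr mulr0.
Qed.

Lemma anti_jordan_op_yxx (B : algType F) (x y : B) :
  anti_jordan_op y x x = - lie_op x x y.
Proof.
rewrite /anti_jordan_op /lie_op /commutator subrr mulr0 add0r.
by rewrite -[y * x - _]opprB mulrN opprB addrC.
Qed.

(** Since [e1] squares to zero, only the middle term [-2 e1 e2 e1 = -2 e1] survives. *)
Lemma zmat_op_lie12 :
  zmat_op (lie F) (mat_e1 F) (mat_e1 F) (mat_e2 F) = -2 *: mat_e1 F.
Proof.
apply: val_inj; rewrite /= lie_opxx expr2 -!mulmxE !mul_delta_mx_cond /=.
by rewrite mulr0n !(mulmx0, mul0mx) subr0 sub0r scaleNr.
Qed.

Lemma zmat_op_lie21 :
  zmat_op (lie F) (mat_e2 F) (mat_e2 F) (mat_e1 F) = -2 *: mat_e2 F.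
Proof.
apply: val_inj; rewrite /= lie_opxx expr2 -!mulmxE !mul_delta_mx_cond /=.
by rewrite mulr0n !(mulmx0, mul0mx) subr0 sub0r scaleNr.
Qed.

Lemma zmat_op_liexx (x : zmat F) : zmat_op (lie F) x x x = 0.
Proof. by apply: val_inj; exact: lie_op_yxx. Qed.

(** The common form to which every generator of either ideal is reduced, up to a scalar. *)
Definition lie_rel (x y : zmat F) : free_alg F :=
  lie_op (phi x) (phi x) (phi y) - phi (zmat_op (lie F) x x y).

(** The expansion of [[a,[a,b]]] gives the parameters 2 and -1; the matrix product [-2 e1] gives the
    third, -2. *)
Lemma lie_rel12 : lie_rel (mat_e1 F) (mat_e2 F) =
  gen_b F * gen_a F ^+ 2 - (2 *: (gen_a F * gen_b F * gen_a F)
    + -1 *: (gen_a F ^+ 2 * gen_b F) + -2 *: gen_a F).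
Proof.
rewrite /lie_rel zmat_op_lie12 linearZ /= !phi_e1 phi_e2 lie_opxx scaleN1r.
by rewrite (opprD (_ - _)) addrA.
Qed.

Lemma lie_rel21 : lie_rel (mat_e2 F) (mat_e1 F) =
  gen_b F ^+ 2 * gen_a F - (2 *: (gen_b F * gen_a F * gen_b F)
    + -1 *: (gen_a F * gen_b F ^+ 2) + -2 *: gen_b F).
Proof.
rewrite /lie_rel zmat_op_lie21 linearZ /= !phi_e2 phi_e1 lie_opxx_sym scaleN1r.
by rewrite (opprD (_ - _)) addrA.
Qed.

Lemma lie_relxx (x : zmat F) : lie_rel x x = 0.
Proof. by rewrite /lie_rel zmat_op_liexx linear0 lie_op_yxx subrr. Qed.

(** The hypotheses range over all algebras because each is applied twice: in the free algebra and in
    the matrix algebra. *)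
Lemma envelope_ideal (w : trilinear_op F) (c d : F) :
    (forall (B : algType F) (x y : B), w B x x y = lie_op x x y) ->
    (forall (B : algType F) (x y : B), w B x y x = c *: lie_op x x y) ->
    (forall (B : algType F) (x y : B), w B y x x = d *: lie_op x x y) ->
  ideal_gen (envelope_rel w) =i ideal_gen (down_up_rel (2 : F) (-1) (-2)).
Proof.
move=> w_xxy w_xyx w_yxx; pose e1 := mat_e1 F; pose e2 := mat_e2 F.
have phiZ k (x : zmat F) : phi (k *: x) = k *: phi x by rewrite linearZ.
have xxy (x y : zmat F) :
    w _ (phi x) (phi x) (phi y) - phi (zmat_op w x x y) = lie_rel x y.
  by rewrite w_xxy; congr (_ - phi _); apply: val_inj; exact: w_xxy.
have xyx (x y : zmat F) :
    w _ (phi x) (phi y) (phi x) - phi (zmat_op w x y x) = c *: lie_rel x y.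
  rewrite w_xyx /lie_rel [RHS]scalerBr -phiZ; congr (_ - phi _).
  by apply: val_inj; exact: w_xyx.
have yxx (x y : zmat F) :
    w _ (phi y) (phi x) (phi x) - phi (zmat_op w y x x) = d *: lie_rel x y.
  rewrite w_yxx /lie_rel [RHS]scalerBr -phiZ; congr (_ - phi _).
  by apply: val_inj; exact: w_yxx.
have e1P : e1 \in [:: e1; e2] by exact: mem_head.
have e2P : e2 \in [:: e1; e2] by rewrite inE mem_head orbT.
have E12 : lie_rel e1 e2 \in ideal_gen (envelope_rel w).
  apply: mem_ideal_gen; exists e1, e1, e2.
  by split; [exact: e1P | exact: e1P | exact: e2P | rewrite xxy].
have E21 : lie_rel e2 e1 \in ideal_gen (envelope_rel w).
  apply: mem_ideal_gen; exists e2, e2, e1.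
  by split; [exact: e2P | exact: e2P | exact: e1P | rewrite xxy].
have I x y : x \in [:: e1; e2] -> y \in [:: e1; e2] ->
    lie_rel x y \in ideal_gen (down_up_rel (2 : F) (-1) (-2)).
  (* Equal arguments give zero; the two mixed pairs give the two down-up relations. *)
  rewrite !inE => /pred2P[]-> /pred2P[]->; rewrite ?lie_relxx ?rpred0 //.
  - by apply: mem_ideal_gen; right; exact: lie_rel12.
  - by apply: mem_ideal_gen; left; exact: lie_rel21.
move=> r; apply/idP/idP; apply: ideal_gen_min => {}r; last first.
  by case=> ->;
    [rewrite -lie_rel21; exact: E21 | rewrite -lie_rel12; exact: E12].
case=> x [y [z [xe ye ze ->]]].
(* Pigeonhole: three arguments taken from two basis vectors. *)
have : [\/ x = y, x = z | y = z].
  move: xe ye ze; move: (e1) (e2) => u v; rewrite !inE.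
  by do 3![case/pred2P=> ->]; (constructor 1 + constructor 2 + constructor 3).
case=> E; subst.
- by rewrite xxy; exact: I.
- by rewrite xyx; apply: ideal_genZ; exact: I.
- by rewrite yxx; apply: ideal_genZ; exact: I.
Qed.

End Envelope.

Lemma anti_jordan_ideal (F : fieldType) :
  ideal_gen (envelope_rel (anti_jordan F))
    =i ideal_gen (down_up_rel (2 : F) (-1) (-2)).
Proof.
apply: (@envelope_ideal F _ 0 (-1)) => B x y.
- exact: anti_jordan_op_xxy.
- by rewrite scale0r; exact: anti_jordan_op_xyx.
- by rewrite scaleN1r; exact: anti_jordan_op_yxx.
Qed.

Lemma lie_ideal (F : fieldType) :
  ideal_gen (envelope_rel (lie F)) =i ideal_gen (down_up_rel (2 : F) (-1) (-2)).
Proof.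
apply: (@envelope_ideal F _ (-1) 0) => B x y //.
- by rewrite scaleN1r; exact: lie_op_xyx.
- by rewrite scale0r; exact: lie_op_yxx.
Qed.

Theorem proposition4p26 (F : fieldType) (char0 : [pchar F] =i pred0) :
  alg_isomorphic (universal_envelope (anti_jordan F))
                 (down_up_algebra (2 : F) (-1) (-2))
  /\ alg_isomorphic (universal_envelope (anti_jordan F))
                    (universal_envelope (lie F)).
Proof.
split; apply: alg_quot_isomorphic => r; first exact: anti_jordan_ideal.
(* The two envelope ideals coincide, each being the down-up ideal. *)
exact: etrans (anti_jordan_ideal r) (esym (lie_ideal r)).
Qed.
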